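(* Let $a<b$ and $c<d$ be real numbers, let $\Delta=[a,b]\times[c,d]\subset\mathbb{R}^2$, and let $f:\Delta\to\mathbb{R}$ be a coordinated $P$-function on $\Delta$ (that is, $f$ belongs to the class $PX(f,\Delta)$). Suppose that $f_x\in L_1[c,d]$ for all $x\in[a,b]$ and $f_y\in L_1[a,b]$ for all $y\in[c,d]$. Then $$\begin{aligned} f\left(\frac{a+b}{2},\frac{c+d}{2}\right)&\le \frac{1}{b-a}\int_a^b f\left(x,\frac{c+d}{2}\right)dx+\frac{1}{d-c}\int_c^d f\left(\frac{a+b}{2},y\right)dy\\ &\le \frac{4}{(b-a)(d-c)}\int_a^b\int_c^d f(x,y)\,dy\,dx\\ &\le \frac{2}{b-a}\left[\int_a^b f(x,c)\,dx+\int_a^b f(x,d)\,dx\right]+\frac{2}{d-c}\left[\int_c^d f(a,y)\,dy+\int_c^d f(b,y)\,dy\right].\end{aligned}$$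
   Context: A function $h:I\subseteq\mathbb{R}\to\mathbb{R}$ on an interval $I$ is a $P$-function (belongs to the class $P(I)$) if it is nonnegative and for all $u,v\in I$ and $\lambda\in[0,1]$, $h(\lambda u+(1-\lambda)v)\le h(u)+h(v)$. For $f:\Delta=[a,b]\times[c,d]\to\mathbb{R}$, the partial mappings are $f_y:[a,b]\to\mathbb{R}$, $f_y(u)=f(u,y)$ (for $y\in[c,d]$) and $f_x:[c,d]\to\mathbb{R}$, $f_x(v)=f(x,v)$ (for $x\in[a,b]$). The function $f$ is called a coordinated $P$-function on $\Delta$ if $f_y$ is a $P$-function on $[a,b]$ for all $y\in[c,d]$ and $f_x$ is a $P$-function on $[c,d]$ for all $x\in[a,b]$; this class is denoted $PX(f,\Delta)$. *)

(* Defs.v *)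
From HB Require Import structures.
From mathcomp Require Export all_boot all_order all_algebra.
From mathcomp Require Export all_classical all_reals all_analysis.
Export Order.TTheory GRing.Theory Num.Theory numFieldNormedType.Exports.
Set Implicit Arguments.
Unset Strict Implicit.
Unset Printing Implicit Defensive.

Local Open Scope ring_scope.

(* A function on a subset of R (resp. R x R) is represented by a total function
   R -> R (resp. R -> R -> R) of which only the values on that subset are
   used. *)

Definition P_function (R : realType) (I : interval R) (h : R -> R) : Prop :=
  (forall u, u \in I -> 0 <= h u) /\
  (forall u v l, u \in I -> v \in I -> l \in `[0, 1] ->
    h (l * u + (1 - l) * v) <= h u + h v).

Definition coordinated_P_function (R : realType) (a b c d : R)
    (f : R -> R -> R) : Prop :=
  (forall y, y \in `[c, d] -> P_function `[a, b] (fun u => f u y)) /\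
  (forall x, x \in `[a, b] -> P_function `[c, d] (fun v => f x v)).

(* Lebesgue measure on the sigma-algebra of all Lebesgue-measurable sets; the
   library's [lebesgue_measure] is its restriction to the Borel sets, for which
   integrability would also require Borel measurability. *)
Notation leb := completed_lebesgue_measure.

(* Main.v *)
Require Import Defs.
From mathcomp Require Import measurable_realfun ring lra.
Local Open Scope classical_set_scope.
Local Open Scope ring_scope.

(** A P-function need not be measurable: every function with values in
  [[1, 2]] is one.  In particular nothing makes the inner integral
  [F x = \int_[c, d] f x y dy] a measurable function of [x], and the two iterated
  integrals of [f] need not agree, so Fubini is of no use.  But [F] is
  nonnegative, and the integral of a nonnegative function is by definition the
  supremum of the integrals of the simple functions below it, measurable or
  not.  This lower integral is monotone, and monotonicity is enough.

  The one-dimensional inequality behind everything is, for a P-function [h] on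
  [[a, b]] with midpoint [m],
    [h m / 2 <= 1 / (b - a) * \int_[a, b] h <= h a + h b].
  On the right, [h] is below the constant [h a + h b]
  ([P_function_Rintegral_le]).  On the left, the textbook proof integrates
  [h m <= h x + h (a + b - x)], which needs an additive integral.  Instead,
  [h m <= h u + h v] holds for all [u <= m < v]; so with [p] the infimum of [h]
  on [[a, m]], the step function equal to [p] on [[a, m]] and to [h m - p] on
  []m, b]] is below [h], and its integral is [h m * (b - a) / 2] whatever [p]
  is ([P_function_midpoint_le]).

  The defining inequality of P-functions, integrated in [y], says that [F] is
  again a P-function ([P_function_Rintegral]).  The theorem then follows by
  applying the one-dimensional inequality to the sections [f x] and [f ^~ y] and
  to [F], whose midpoint and endpoint values are integrals of sections of
  [f]. *)

(** Both sides are suprema of integrals of simple functions, and a simple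
  function below [f] is also below [g]; so arbitrary nonnegative functions can
  be compared. *)
Lemma ge0_le_lower_integral d (T : measurableType d) (R : realType)
    (mu : {measure set T -> \bar R}) (D : set T) (f g : T -> \bar R) :
  (forall x, D x -> (0 <= f x)%E) -> (forall x, D x -> (f x <= g x)%E) ->
  (\int[mu]_(x in D) f x <= \int[mu]_(x in D) g x)%E.
Proof.
move=> f0 fg; have g0 x : D x -> (0 <= g x)%E.
  by move=> Dx; rewrite (le_trans (f0 _ Dx)) ?fg.
rewrite !ge0_integralE//; apply: ge_ereal_sup => _ [h hf <-].
apply: ereal_sup_ubound; exists h => //= x.
rewrite (le_trans (hf x))// /patch; case: ifPn => // /set_mem; exact: fg.
Qed.

Lemma measurable_itv_leb (R : realType) (i : interval R) :
  measurable ([set` i] : set (caratheodory_type (wlength (@idfun R))^*%mu)).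
Proof. by apply: sub_caratheodory; exact: measurable_itv. Qed.

Lemma leb_itv (R : realType) (a b : R) (x y : bool) : a <= b ->
  leb [set` Interval (BSide x a) (BSide y b)] = (b - a)%:E.
Proof.
move=> ab; set J := [set` _].
(* both measures are restrictions of the same outer measure *)
have -> : leb J = lebesgue_measure J by [].
rewrite lebesgue_measure_itv /= lte_fin.
move: ab; rewrite le_eqVlt => /predU1P[->|->]; last by rewrite EFinB.
by rewrite ltxx subrr.
Qed.

(** [Rintegral] sends an infinite integral to [0], whence the finiteness
  hypothesis on the larger function. *)
Lemma le_lower_Rintegral d (T : measurableType d) (R : realType)
    (mu : {measure set T -> \bar R}) (D : set T) (f g : T -> R) :
  (forall x, D x -> 0 <= f x) -> (forall x, D x -> f x <= g x) ->
  (\int[mu]_(x in D) (g x)%:E < +oo)%E ->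
  \int[mu]_(x in D) f x <= \int[mu]_(x in D) g x.
Proof.
move=> f0 fg goo.
have g0 x : D x -> (0 <= (g x)%:E)%E.
  by move=> Dx; rewrite lee_fin (le_trans (f0 _ Dx)) ?fg.
have fgE : (\int[mu]_(x in D) (f x)%:E <= \int[mu]_(x in D) (g x)%:E)%E.
  by apply: ge0_le_lower_integral => x Dx; rewrite lee_fin ?f0 ?fg.
have If0 : (0 <= \int[mu]_(x in D) (f x)%:E)%E.
  by apply: integral_ge0 => x Dx; rewrite lee_fin f0.
apply: fine_le => //; rewrite ge0_fin_numE//; first exact: le_lt_trans fgE goo.
exact: integral_ge0.
Qed.

(** Every point of a segment is a convex combination of its ends; this form of
  the defining inequality has no weight in it. *)
Lemma P_function_between {R : realType} {I : interval R} {h : R -> R} {u w v} :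
  P_function I h -> u \in I -> v \in I -> u <= w <= v -> h w <= h u + h v.
Proof.
move=> [h0 hP] uI vI /andP[uw wv].
have [uv|vu] := ltP u v; last first.
  have -> : w = u by apply/le_anti; rewrite uw (le_trans wv vu).
  by rewrite lerDl h0.
have vu0 : v - u != 0 by rewrite subr_eq0 gt_eqF.
have := hP u v ((v - w) / (v - u)) uI vI.
have -> : (v - w) / (v - u) * u + (1 - (v - w) / (v - u)) * v = w by field.
apply; rewrite in_itv /= divr_ge0 ?subr_ge0 ?(ltW uv)//=.
by rewrite ler_pdivrMr ?subr_gt0// mul1r lerB.
Qed.

Lemma integral_two_step d (T : measurableType d) (R : realType)
    (mu : {measure set T -> \bar R}) (D A B : set T) (p q : R) :
  measurable D -> measurable A -> measurable B -> A `<=` D -> B `<=` D ->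
  0 <= p -> 0 <= q ->
  (\int[mu]_(x in D) (p * \1_A x + q * \1_B x)%:E =
   p%:E * mu A + q%:E * mu B)%E.
Proof.
move=> mD mA mB AD BD p0 q0.
have mI (k : R) (C : set T) : measurable C ->
    measurable_fun D (fun x => k%:E * (\1_C x)%:E)%E.
  move=> mC; apply: measurable_funeM; apply/measurable_EFinP.
  exact: measurable_indic.
under eq_integral do rewrite EFinD !EFinM.
have nn (k : R) (C : set T) x : 0 <= k -> (0 <= k%:E * (\1_C x)%:E)%E.
  by move=> k0; rewrite mule_ge0 ?lee_fin.
rewrite ge0_integralD//; try by [move=> x _; exact: nn|exact: mI].
rewrite !ge0_integralZl_EFin//; try by
  [move=> x _; rewrite lee_fin|apply/measurable_EFinP; exact: measurable_indic].
by rewrite !integral_indic// !setIidl.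
Qed.

Lemma P_function_le_endpoints {R : realType} {a b : R} {h : R -> R} {x} :
  P_function `[a, b] h -> x \in `[a, b] -> h x <= h a + h b.
Proof.
move=> hP xab; have [ax xb] : a <= x /\ x <= b by rewrite !(itvP xab).
have ab := le_trans ax xb.
by apply: (P_function_between hP); rewrite ?bound_itvE ?ax.
Qed.

Lemma integral_cst_itv (R : realType) (a b k : R) : a <= b ->
  (\int[leb]_(x in `[a, b]) k%:E)%E = (k * (b - a))%:E.
Proof.
move=> ab; transitivity (k%:E * leb `[a, b])%E.
  by apply: integral_cst; exact: measurable_itv_leb.
by rewrite leb_itv.
Qed.

(** P-functions are bounded on compact intervals, by their endpoint values. *)
Lemma P_function_lty {R : realType} {a b : R} {h : R -> R} :
  a < b -> P_function `[a, b] h -> (\int[leb]_(x in `[a, b]) (h x)%:E < +oo)%E.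
Proof.
move=> ab hP.
apply: (@le_lt_trans _ _ (\int[leb]_(x in `[a, b]) (h a + h b)%:E)%E).
  apply: ge0_le_lower_integral => x xab; rewrite lee_fin.
    exact: hP.1.
  exact: P_function_le_endpoints hP xab.
by rewrite integral_cst_itv ?ltry ?ltW.
Qed.

Lemma P_function_Rintegral_le {R : realType} {a b : R} {h : R -> R} :
  a < b -> P_function `[a, b] h ->
  \int[leb]_(x in `[a, b]) h x <= (h a + h b) * (b - a).
Proof.
move=> ab hP.
have -> : (h a + h b) * (b - a) = \int[leb]_(x in `[a, b]) (h a + h b).
  by rewrite /Rintegral integral_cst_itv ?ltW.
apply: le_lower_Rintegral => [x|x|]; first exact: hP.1.
- exact: P_function_le_endpoints hP.
- by rewrite integral_cst_itv ?ltry ?ltW.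
Qed.

(** The values of [h] at two points on either side of the midpoint sum to at
  least [h m].  Hence, if [p] is the greatest lower bound of [h] on the left
  half, then [h m - p] is a lower bound on the right half, and the average of the
  two is [h m / 2].  As only a step function is integrated, this holds
  for the lower integral of a nonmeasurable [h]. *)
Lemma P_function_midpoint_le {R : realType} {a b : R} {h : R -> R} :
  a < b -> P_function `[a, b] h ->
  h ((a + b) / 2) * (b - a) <= 2 * \int[leb]_(x in `[a, b]) h x.
Proof.
move=> ab hP; set m := (a + b) / 2.
have am : a < m by rewrite /m midf_lt.
have mb : m < b by rewrite /m midf_lt.
pose S := h @` `[a, m]%classic.
have mS : S (h m) by exists m => //=; rewrite in_itv /= lexx ltW.
have S0 : lbound S 0.
  move=> _ [x /= xam <-]; apply: hP.1; move: xam; rewrite !in_itv /=.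
  by move=> /andP[-> /= xm]; rewrite (le_trans xm) ?ltW.
have hS : has_inf S by split; [exists (h m)|exists 0].
(* h m itself is in S, so that p <= h m and the other value q is nonnegative *)
set p := inf S; pose q := h m - p.
have p0 : 0 <= p by apply: lb_le_inf => //; exists (h m).
have pS x : x \in `[a, m] -> p <= h x.
  by move=> xam; apply: (ge_inf hS.2); exists x.
have q0 : 0 <= q by rewrite subr_ge0 (ge_inf hS.2).
have qS x : x \in `]m, b] -> q <= h x.
  rewrite in_itv /= => /andP[mx xb]; rewrite /q lerBlDr -lerBlDl.
  apply: lb_le_inf; first by exists (h m).
  move=> _ [u /= + <-]; rewrite in_itv /= => /andP[au um].
  rewrite lerBlDl addrC; apply: (P_function_between hP).
  - by rewrite in_itv /= au (le_trans um) ?ltW.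
  - by rewrite in_itv /= xb (le_trans _ (ltW mx)) ?ltW.
  - by rewrite um ltW.
pose s x : R := p * \1_(`[a, m]%classic) x + q * \1_(`]m, b]%classic) x.
have mI (i : interval R) := measurable_itv_leb R i.
have s0 x : 0 <= s x by rewrite addr_ge0 ?mulr_ge0.
have sh x : x \in `[a, b] -> s x <= h x.
  rewrite in_itv /= => /andP[ax xb]; rewrite /s !indicE.
  have -> : (x \in `[a, m]%classic) = (x <= m) by rewrite mem_setE in_itv /= ax.
  have -> : (x \in `]m, b]%classic) = (m < x).
    by rewrite mem_setE in_itv /= xb andbT.
  have [xm|mx] := leP x m; rewrite mulr1 mulr0 ?addr0 ?add0r.
    by rewrite pS// in_itv /= ax.
  by rewrite qS// in_itv /= mx.
have Is : (\int[leb]_(x in `[a, b]) (s x)%:E)%E = (h m * (b - a) / 2)%:E.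
  transitivity (p%:E * leb `[a, m] + q%:E * leb `]m, b])%E.
    apply: integral_two_step => //.
    - by apply: subset_itv; rewrite bnd_simp// ltW.
    - by apply: subset_itv; rewrite bnd_simp// ltW.
  rewrite !leb_itv ?ltW// -!EFinM -EFinD; congr EFin.
  by rewrite /q /m; field.
have : h m * (b - a) / 2 <= \int[leb]_(x in `[a, b]) h x.
  rewrite -[leLHS]/(fine (h m * (b - a) / 2)%:E) -Is.
  apply: le_lower_Rintegral; [by []|exact: sh|exact: P_function_lty ab hP].
by rewrite ler_pdivrMr// [leRHS]mulrC.
Qed.

(** This lets the one-dimensional inequalities be applied in [x] to the partial
  integral, and replaces every exchange of integrals. *)
Lemma P_function_Rintegral (R : realType) (I : interval R) (c d : R)
    (f : R -> R -> R) :
  (forall y, y \in `[c, d] -> P_function I (fun u => f u y)) ->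
  (forall x, x \in I -> leb.-integrable `[c, d] (fun y => (f x y)%:E)) ->
  P_function I (fun x => \int[leb]_(y in `[c, d]) f x y).
Proof.
move=> fP fint; split=> [u uI|u v l uI vI l01].
  by apply: Rintegral_ge0 => y /= ycd; exact: (fP _ ycd).1.
have mcd := measurable_itv_leb R `[c, d].
have luvI : l * u + (1 - l) * v \in I.
  have /andP[l0 l1] : 0 <= l <= 1 by move: l01; rewrite in_itv.
  have [uv|/ltW vu] := leP u v.
    by apply: (@interval_is_interval _ I u v uI vI); apply/andP; split; nra.
  by apply: (@interval_is_interval _ I v u vI uI); apply/andP; split; nra.
rewrite -RintegralD//; try exact: fint.
apply: le_Rintegral => //; first exact: fint.
- exact: (integrableD mcd (fint u uI) (fint v vI)).
- by move=> y /= ycd; apply: (fP y ycd).2.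
Qed.

Theorem theorem8 (R : realType) (a b c d : R) (f : R -> R -> R)
  (hab : a < b) (hcd : c < d)
  (hf : coordinated_P_function a b c d f)
  (hfx : forall x, x \in `[a, b] ->
     leb.-integrable `[c, d] (fun y => (f x y)%:E))
  (hfy : forall y, y \in `[c, d] ->
     leb.-integrable `[a, b] (fun x => (f x y)%:E)) :
  [/\ f ((a + b) / 2) ((c + d) / 2)
      <= 1 / (b - a) * (\int[leb]_(x in `[a, b]) f x ((c + d) / 2))
       + 1 / (d - c) * (\int[leb]_(y in `[c, d]) f ((a + b) / 2) y),
      1 / (b - a) * (\int[leb]_(x in `[a, b]) f x ((c + d) / 2))
       + 1 / (d - c) * (\int[leb]_(y in `[c, d]) f ((a + b) / 2) y)
      <= 4 / ((b - a) * (d - c)) *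
         (\int[leb]_(x in `[a, b]) (\int[leb]_(y in `[c, d]) f x y))
    & 4 / ((b - a) * (d - c)) *
         (\int[leb]_(x in `[a, b]) (\int[leb]_(y in `[c, d]) f x y))
      <= 2 / (b - a) * ((\int[leb]_(x in `[a, b]) f x c)
                        + (\int[leb]_(x in `[a, b]) f x d))
       + 2 / (d - c) * ((\int[leb]_(y in `[c, d]) f a y)
                        + (\int[leb]_(y in `[c, d]) f b y))].
Proof.
have [fyP fxP] := hf.
set mx := (a + b) / 2; set my := (c + d) / 2.
set A := \int[leb]_(x in _) f x my; set B := \int[leb]_(y in _) f mx y.
pose F x := \int[leb]_(y in `[c, d]) f x y.
set I := \int[leb]_(x in _) _.
set A0 := \int[leb]_(x in _) f x c; set A1 := \int[leb]_(x in _) f x d.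
set B0 := \int[leb]_(y in _) f a y; set B1 := \int[leb]_(y in _) f b y.
have mxab : mx \in `[a, b] by rewrite in_itv /= !midf_le ?ltW.
have mycd : my \in `[c, d] by rewrite in_itv /= !midf_le ?ltW.
have ccd : c \in `[c, d] by rewrite bound_itvE ltW.
have dcd : d \in `[c, d] by rewrite bound_itvE ltW.
have mab := measurable_itv_leb R `[a, b].
have ba0 : 0 < b - a by rewrite subr_gt0.
have dc0 : 0 < d - c by rewrite subr_gt0.
have FP : P_function `[a, b] F by exact: P_function_Rintegral fyP hfx.
have fA : f mx my * (b - a) <= 2 * A.
  exact: P_function_midpoint_le hab (fyP my mycd).
have fB : f mx my * (d - c) <= 2 * B.
  exact: P_function_midpoint_le hcd (fxP mx mxab).
(* F mx = B, F a = B0 and F b = B1 by definition *)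
have BI : B * (b - a) <= 2 * I by exact: P_function_midpoint_le hab FP.
have IB : I <= (B0 + B1) * (b - a) by exact: P_function_Rintegral_le hab FP.
(* the one-dimensional inequalities for the sections f x, integrated in x *)
have AI : A * (d - c) <= 2 * I.
  rewrite mulrC -ler_pdivrMl// mulrA -RintegralZl//; last exact: hfy.
  apply: le_lower_Rintegral.
  - move=> x /= xab; apply: mulr_ge0; last exact: (fyP my mycd).1.
    by rewrite mulr_ge0 ?invr_ge0// ltW.
  - move=> x /= xab; rewrite -mulrA ler_pdivrMl// mulrC.
    exact: P_function_midpoint_le hcd (fxP x xab).
  - exact: P_function_lty hab FP.
have IA : I <= (A0 + A1) * (d - c).
  rewrite /A0 /A1 -RintegralD//; [|exact: hfy|exact: hfy].
  have intS : leb.-integrable `[a, b] (fun x => (f x c + f x d)%:E).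
    exact: (integrableD mab (hfy c ccd) (hfy d dcd)).
  rewrite -RintegralZr//.
  apply: le_lower_Rintegral.
  - exact: FP.1.
  - move=> x /= xab; exact: P_function_Rintegral_le hcd (fxP x xab).
  - have := integrableZr mab (d - c) intS.
    move=> /integrableP[_]; apply: le_lt_trans.
    apply: ge0_le_lower_integral => x xab; rewrite ?lee_fin /=.
    + by rewrite mulr_ge0 ?(ltW dc0)// addr_ge0 ?(fyP c ccd).1 ?(fyP d dcd).1.
    + by rewrite ler_norm.
set p := (b - a)^-1; set q := (d - c)^-1.
have p0 : 0 < p by rewrite invr_gt0.
have q0 : 0 < q by rewrite invr_gt0.
have fAp : f mx my <= 2 * A * p by rewrite ler_pdivlMr.
have fBq : f mx my <= 2 * B * q by rewrite ler_pdivlMr.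
have AIpq : A * p <= 2 * (I * (p * q)).
  by rewrite (mulrC p) !mulrA ler_pM2r// ler_pdivlMr.
have BIpq : B * q <= 2 * (I * (p * q)).
  by rewrite !mulrA ler_pM2r// ler_pdivlMr.
have IApq : I * (p * q) <= (A0 + A1) * p.
  by rewrite (mulrC p) mulrA ler_pM2r// ler_pdivrMr.
have IBpq : I * (p * q) <= (B0 + B1) * q.
  by rewrite mulrA ler_pM2r// ler_pdivrMr.
rewrite !invfM -/p -/q; split.
- move: (f mx my) fAp fBq => v; clear; lra.
- clear -AIpq BIpq; lra.
- clear -IApq IBpq; lra.
Qed.
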